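(* Let $E$ be a set of $n$ points in $\mathbb{R}^3$ and let $j,k\ge 2$. The number of tuples $(x_1,x_2,x_3,x_4)\in E^4$ with $\angle(x_1,x_2,x_3)=\angle(x_2,x_3,x_4)=\pi/2$ such that the line through $x_1,x_2$ contains at least $j$ points of $E$, the line through $x_3,x_4$ contains at least $k$ points of $E$, and these two lines are not parallel, is $$\lesssim\left(\frac{n^2}{j^2}+n\right)\left(\frac{n^2}{k^2}+n\right).$$
   Context: $\angle(x,y,z)\in[0,\pi]$ denotes the angle at $y$ between $x-y$ and $z-y$ (for $x\ne y\ne z$). $X\lesssim Y$ means $X\le CY$ for all $n>N$ with constants $C,N$ independent of $n,j,k$. *)

(* Defs.v *)
From mathcomp Require Export all_boot all_order all_algebra finmap.
From mathcomp Require Export boolp classical_sets reals trigo.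

Set Implicit Arguments.
Unset Strict Implicit.
Unset Printing Implicit Defensive.

Import GRing.Theory Num.Theory.

Local Open Scope ring_scope.

Notation point R := 'rV[R]_3.

Definition dot (R : realType) (u v : point R) : R :=
  \sum_(i < 3) u 0 i * v 0 i.

(* The norm that the library puts on row vectors is the sup norm, hence the
   explicit Euclidean norm. *)
Definition enorm (R : realType) (u : point R) : R := Num.sqrt (dot u u).

(* Since x / 0 = 0 and acos 0 = pi / 2, the angle takes the value pi / 2 in the
   degenerate cases x = y and y = z; uses of it must require x != y and
   y != z. *)
Definition angle (R : realType) (x y z : point R) : R :=
  acos (dot (x - y) (z - y) / (enorm (x - y) * enorm (z - y))).

(* A line only when a != b. *)
Definition line_through (R : realType) (a b : point R) : set (point R) :=
  [set p | exists t : R, p = a + t *: (b - a)].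

(* Parallelism of the lines through a, b and through c, d, for a != b and
   c != d; coincident lines count as parallel. *)
Definition parallel_lines (R : realType) (a b c d : point R) : Prop :=
  exists t : R, d - c = t *: (b - a).

Definition rich (R : realType) (E : {fset point R}) (m : nat)
    (L : set (point R)) : Prop :=
  (m <= #|` [fset p in E | `[< L p >]]%fset|)%N.

Definition good_tuple (R : realType) (E : {fset point R}) (j k : nat)
    (x1 x2 x3 x4 : point R) : Prop :=
  [/\ x1 != x2, x2 != x3 & x3 != x4] /\
  [/\ angle x1 x2 x3 = pi / 2, angle x2 x3 x4 = pi / 2,
      rich E j (line_through x1 x2), rich E k (line_through x3 x4)
    & ~ parallel_lines x1 x2 x3 x4].

Definition good_tuples (R : realType) (E : {fset point R}) (j k : nat) :
    {fset point R * point R * point R * point R} :=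
  [fset x in E `*` E `*` E `*` E |
     `[< good_tuple E j k x.1.1.1 x.1.1.2 x.1.2 x.2 >]]%fset.

(* Main.v *)
(** Two non-parallel lines have at most one common perpendicular, so a tuple is
    determined by the incidences of [x1] with the first line and of [x4] with the
    second, and it suffices to show that the lines containing at least [j] points
    of [E] carry [O(n^2/j^2 + n)] incidences. A generic projection reduces this
    consequence of the Szemeredi-Trotter theorem to the plane. There, following
    Szekely, join the consecutive points on each rich line. Each pair of lines
    accounts for at most one crossing of edges, and a crossing-free straight-line graph has at
    most three edges per vertex; applying this to the graph induced on a random
    set of points, a class of a random coloring with [K] colors, bounds the number
    [e] of edges by [3 n K + M^2 / K^2], where [M] is the number of rich lines.
    Since [M] is at most [1/j] times the number of incidences, a suitable [K]
    gives the bound. *)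
Require Import Defs.
From mathcomp Require Import ring zify.

Set Implicit Arguments.
Unset Strict Implicit.
Unset Printing Implicit Defensive.

Import Order.TTheory GRing.Theory Num.Theory.

Local Open Scope ring_scope.

(** * Finite counting: comparing cardinals through a relation, and the choice of the sampling
    rate *)

Lemma leq_card_rel (A B : finType) (D : {set A}) (C : {set B})
    (P : A -> B -> Prop) :
  (forall x, x \in D -> exists2 y, y \in C & P x y) ->
  (forall x x' y, x \in D -> x' \in D -> P x y -> P x' y -> x = x') ->
  (#|D| <= #|C|)%N.
Proof.
move=> total inj.
have [->|[x0 x0D]] := set_0Vmem D; first by rewrite cards0.
have [y0 _ _] := total _ x0D.
have /fin_all_exists[f fP] x : exists y, x \in D -> y \in C /\ P x y.
  case: (boolP (x \in D)) => [/total[y yC Pxy]|_]; first by exists y.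
  by exists y0.
rewrite -(card_in_imset (f := f)) => [|x x' xD x'D fxx'].
  by apply/subset_leq_card/fintype.subsetP => _ /imsetP[x xD ->]; case: (fP x xD).
by apply: (inj _ _ (f x)) => //; [case: (fP x xD)|rewrite fxx'; case: (fP x' x'D)].
Qed.

(** The least [K] with [4 I <= j^2 K^2] gives [I <= 12 n K]; its minimality gives [j^2 K^2 <= 16 I]
    when [K >= 2]. Squaring the first bound and inserting the second produces [144 * 16 = 2304]. *)
Lemma optimize_sampling (n j M I : nat) : (0 < j)%N -> (j * M <= I)%N ->
  (forall K, (0 < K)%N -> (I * K ^ 2 <= 6 * n * K ^ 3 + 2 * M ^ 2)%N) ->
  (I * j ^ 2 <= 2304 * (n ^ 2 + n * j ^ 2))%N.
Proof.
move=> j0 jM sampled; have [->|I0] := posnP I; first by lia.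
have j2 : (0 < j ^ 2)%N by rewrite expn_gt0 j0.
(* For this [K] the term [2 M^2] is at most half of [I K^2]. *)
have [K jK Kmin] : exists2 K, (4 * I <= j ^ 2 * K ^ 2)%N &
    forall K', (4 * I <= j ^ 2 * K' ^ 2)%N -> (K <= K')%N.
  have ex : exists K, (4 * I <= j ^ 2 * K ^ 2)%N.
    exists (4 * I)%N; apply: leq_trans (leq_pmull _ j2).
    by rewrite -mulnn leq_pmull // muln_gt0.
  by exists (ex_minn ex); case: ex_minnP.
have K0 : (0 < K)%N.
  by rewrite lt0n; apply: contraTneq jK => ->; rewrite -ltnNge muln0 muln_gt0.
have M2 : (j ^ 2 * M ^ 2 <= I ^ 2)%N by rewrite -expnMn leq_exp2r.
have low : (I <= 12 * n * K)%N.
  have Q0 : (0 < j ^ 2 * K ^ 2)%N by rewrite muln_gt0 j2 expn_gt0 K0.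
  rewrite -(leq_pmul2l Q0).
  have := leq_mul (leqnn (j ^ 2)) (sampled K K0).
  have : (I * (4 * I) <= I * (j ^ 2 * K ^ 2))%N by rewrite leq_pmul2l.
  move: M2; lia.
(* The comparison of [K] with [K.-1] needs [K >= 2]; for [K = 1] the term linear in [n] suffices. *)
have [K1|K2] := leqP K 1.
  have {}low : (I <= 12 * n)%N by have := leq_mul (leqnn (12 * n)) K1; lia.
  by have := leq_mul low (leqnn (j ^ 2)); lia.
have : ~~ (4 * I <= j ^ 2 * K.-1 ^ 2)%N by apply/negP => /Kmin; lia.
rewrite -ltnNge => up.
have KK : (K ^ 2 <= 4 * K.-1 ^ 2)%N.
  by rewrite (_ : 4 = 2 ^ 2)%N // -expnMn leq_exp2r //; lia.
have up' : (j ^ 2 * K ^ 2 <= 16 * I)%N.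
  by have := leq_mul (leqnn (j ^ 2)) KK; lia.
have low2 := leq_mul (leq_mul low low) (leqnn (j ^ 2)).
have h := leq_mul (leqnn (144 * n ^ 2)) up'.
have : (I * (I * j ^ 2) <= I * (2304 * n ^ 2))%N by lia.
by rewrite leq_pmul2l //; lia.
Qed.

(** * Segments in the plane, as graphs of affine functions, and their crossings *)

Section Plane.
Variables (R : realFieldType) (T : finType) (X Y : T -> R).
Hypothesis injX : injective X.

Definition slope (e : T * T) : R := (Y e.2 - Y e.1) / (X e.2 - X e.1).

Definition height (e : T * T) (x : R) : R := Y e.1 + slope e * (x - X e.1).

(** A strict change of sign over the common range of abscissas excludes overlapping collinear edges
    and edges that merely touch. *)
Definition crossing (e f : T * T) : Prop := exists x y,
  [/\ X e.1 <= x <= X e.2, X f.1 <= x <= X f.2 & height e x < height f x] /\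
  [/\ X e.1 <= y <= X e.2, X f.1 <= y <= X f.2 & height f y < height e y].

Lemma height_fst e : height e (X e.1) = Y e.1.
Proof. by rewrite /height subrr mulr0 addr0. Qed.

Lemma height_snd e : e.1 != e.2 -> height e (X e.2) = Y e.2.
Proof.
move=> ne; rewrite /height /slope divfK ?subrKC // subr_eq0.
by rewrite (inj_eq injX) eq_sym.
Qed.

Lemma ltX_neq (e : T * T) : X e.1 < X e.2 -> e.1 != e.2.
Proof. by apply: contraTneq => ->; rewrite ltxx. Qed.

Lemma height_le e f x : e.1 = f.1 -> X e.1 < x ->
  (height e x <= height f x) = (slope e <= slope f).
Proof. by rewrite /height => <- lx; rewrite lerD2l ler_pM2r // subr_gt0. Qed.

Lemma height_lt e f x : e.1 = f.1 -> X e.1 < x ->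
  (height e x < height f x) = (slope e < slope f).
Proof. by rewrite /height => <- lx; rewrite ltrD2l ltr_pM2r // subr_gt0. Qed.

Lemma affine_sign_change (a b x y : R) : a + b * x < 0 -> 0 < a + b * y ->
  exists z, [/\ Num.min x y < z, z < Num.max x y, a + b * z = 0 &
    forall z', a + b * z' = 0 -> z' = z].
Proof.
move=> neg pos.
have b0 : b != 0.
  by apply: contraTneq pos => b0; move: neg; rewrite b0 !mul0r !addr0 => /lt_gtF ->.
exists (- a / b); rewrite mulrCA divff // mulr1 subrr.
have zE z' : a + b * z' = b * (z' - (- a / b)) by field.
move: neg pos; rewrite !zE; split=> //.
- case/orP: (lt_total b0) neg pos => bs.
    by rewrite nmulr_rlt0 // nmulr_rgt0 // subr_gt0 subr_lt0 gt_min => _ ->; rewrite orbT.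
  by rewrite pmulr_rlt0 // subr_lt0 gt_min => ->.
- case/orP: (lt_total b0) neg pos => bs.
    by rewrite nmulr_rlt0 // nmulr_rgt0 // subr_gt0 lt_max => ->.
  by rewrite pmulr_rgt0 // subr_gt0 lt_max => _ ->; rewrite orbT.
move=> z' /eqP; rewrite zE mulf_eq0 (negPf b0) subr_eq0 => /eqP; exact.
Qed.

Lemma crossing_point e f : crossing e f -> exists z,
  [/\ X e.1 < z < X e.2, X f.1 < z < X f.2 &
     forall z', height e z' = height f z' <-> z' = z].
Proof.
case=> x [y [[ex fx ltx] [ey fy lty]]].
pose a := Y e.1 - slope e * X e.1 - (Y f.1 - slope f * X f.1).
pose b := slope e - slope f.
have dE z : a + b * z = height e z - height f z by rewrite /height /a /b; ring.
have [||z [lz uz z0 zu]] := @affine_sign_change a b x y.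
- by rewrite dE subr_lt0.
- by rewrite dE subr_gt0.
have bounds l u : l <= x <= u -> l <= y <= u -> l < z < u.
  move=> /andP[lx xu] /andP[ly yu]; apply/andP; split.
    by apply: le_lt_trans lz; rewrite le_min lx.
  by apply: lt_le_trans uz _; rewrite ge_max xu.
exists z; split; [exact: bounds|exact: bounds|move=> z'; split].
  by move=> h; apply: zu; rewrite dE h subrr.
by move=> ->; apply/eqP; rewrite -subr_eq0 -dE z0.
Qed.

(** * At most three edges per vertex in a crossing-free graph *)

Section Noncrossing.
Variables (S : {set T}) (G : {set T * T}).
Hypothesis GS : forall e, e \in G -> [/\ e.1 \in S, e.2 \in S & X e.1 < X e.2].
Hypothesis G_empty : forall e c, e \in G -> c \in S ->
  X e.1 < X c < X e.2 -> Y c != height e (X c).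
Hypothesis G_noncrossing : forall e f, e \in G -> f \in G -> ~ crossing e f.

(* [a] is the edge following [e] clockwise among the edges leaving their common
   left endpoint to the right, and [w] is the first point that a vertical line
   moving right from that endpoint meets in the wedge between [a] and [e]. *)
Definition wedge (e a : T * T) (w : T) : Prop :=
  [/\ a \in G, a.1 = e.1, slope a < slope e
    & forall f, f \in G -> f.1 = e.1 -> slope f < slope e -> slope f <= slope a]
  /\ [/\ w \in S, X e.1 < X w <= Num.min (X a.2) (X e.2),
      height a (X w) <= Y w <= height e (X w)
    & forall u, u \in S -> X e.1 < X u < X w ->
        ~~ (height a (X u) <= Y u <= height e (X u))].

(* The flag records whether [w] lies on [a]: two wedges can share their first
   point, but not with the same flag. *)
Definition charge (e : T * T) (c : T * option bool) : Prop :=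
  if c.2 is Some t then exists2 a, wedge e a c.1 & t = (Y c.1 == height a (X c.1))
  else c.1 = e.1 /\ forall f, f \in G -> f.1 = e.1 -> slope e <= slope f.

(** Otherwise the right endpoint of the shorter edge would lie inside the longer one, against
    [G_empty]. *)
Lemma slope_inj e f : e \in G -> f \in G -> e.1 = f.1 -> slope e = slope f -> e = f.
Proof.
move=> eG fG e1 es.
wlog le : e f eG fG e1 es / X e.2 <= X f.2.
  move=> H; case/orP: (le_total (X e.2) (X f.2)) => [|h]; first exact: H.
  by apply/esym; apply: H.
have [_ e2S eX] := GS eG; have [_ _ fX] := GS fG.
have hE : height e (X e.2) = height f (X e.2) by rewrite /height es e1.
case: e f e1 es le eG fG eX fX hE e2S => [v b] [v' b'] /= <- es.
rewrite le_eqVlt => /orP[/eqP/injX -> //|lt] eG fG vb vb'.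
rewrite (height_snd (ltX_neq (e := (v, b)) vb)) /= => hE bS.
by have := G_empty fG bS; rewrite /= vb lt hE eqxx => /(_ isT).
Qed.

(** The lowest edge at its left endpoint is charged there. For any other edge the wedge contains the
    right endpoint of [a] or of [e], whichever comes first, so a first point exists. *)
Lemma charge_total e : e \in G ->
  exists2 c, c \in finset.setX S [set: option bool] & charge e c.
Proof.
move=> eG; have [e1S e2S eX] := GS eG.
pose below f := [&& f \in G, f.1 == e.1 & slope f < slope e].
case: (pickP below) => [a0 a0P|none]; last first.
  exists (e.1, None); first by rewrite !inE e1S.
  split=> // f fG fe; rewrite leNgt; apply/negP => lt.
  by have := none f; rewrite /below fG fe eqxx lt.
case: (arg_maxP slope a0P) => a /and3P[aG /eqP ae alt] amax.
have [_ a2S aX] := GS aG.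
pose inw w := [&& w \in S, X e.1 < X w & height a (X w) <= Y w <= height e (X w)].
have [w0 w0P w0min] : exists2 w, inw w & X w <= Num.min (X a.2) (X e.2).
  have [le|lt] := leP (X a.2) (X e.2).
    exists a.2 => //; rewrite /inw a2S -ae aX /= -(height_snd (ltX_neq aX)) lexx /=.
    by rewrite height_le // ltW.
  exists e.2; last exact: lexx.
  rewrite /inw e2S eX /= -(height_snd (ltX_neq eX)) lexx andbT.
  by rewrite height_le ?ae // ltW.
case: (arg_minP X w0P) => w /and3P[wS ew wh] wmin.
exists (w, Some (Y w == height a (X w))); first by rewrite !inE wS.
exists a => //; split; split=> //.
- by move=> f fG fe lt; apply: amax; rewrite /below fG fe eqxx lt.
- by rewrite ew /=; apply: le_trans w0min; apply: wmin.
move=> u uS /andP[eu uw]; apply/negP => uh.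
by have := wmin u; rewrite /inw uS eu uh leNgt uw => /(_ isT).
Qed.

(** The apex of the second wedge comes before [w], so it lies outside the first wedge. If it is
    below [a], then [e'] must cross [a] on the way to [w]; if it is above [e], then [a'] must cross
    [e]. *)
Lemma wedge_apex e a e' a' w : e \in G -> e' \in G ->
  wedge e a w -> wedge e' a' w ->
  (Y w == height a (X w)) = (Y w == height a' (X w)) -> X e.1 < X e'.1 -> False.
Proof.
move=> eG e'G [[aG ae alt _] [wS /andP[ew wmin] /andP[aw we] first]].
move=> [[a'G a'e' alt' _] [_ /andP[ew' wmin'] /andP[aw' we'] _]] same lt.
have := first e'.1; rewrite lt ew'; have [e'S _ _] := GS e'G.
move=> /(_ e'S isT); rewrite negb_and -!ltNge.
move: wmin wmin'; rewrite !le_min => /andP[wa we2] /andP[wa' we2'].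
have strict : height a (X w) < height e (X w) by rewrite height_lt ?ae.
have strict' : height a' (X w) < height e' (X w) by rewrite height_lt ?a'e'.
have [le le'] := (ltW lt, ltW ew').
case/orP=> [low|high].
  (* Equality would put [w] on both [a] and [e']; by the common flag [w] would also lie on [a'],
     which is strictly below [e'] there. *)
  have cr : height a (X w) < height e' (X w).
    rewrite lt_neqAle (le_trans aw we') andbT; apply/eqP => eq.
    have Ya : Y w == height a (X w) by rewrite eq_le aw eq we'.
    by move: Ya strict'; rewrite same => /eqP <-; rewrite ltNge -eq aw.
  apply: (G_noncrossing e'G aG); exists (X e'.1), (X w); rewrite ae !lexx le le' wa we2' /=.
  rewrite (le_trans le le') (le_trans le' we2') (le_trans le' wa).
  by split; split=> //; rewrite height_fst.
have cr : height a' (X w) < height e (X w).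
  rewrite lt_neqAle (le_trans aw' we) andbT; apply/eqP => eq.
  have Ya : Y w == height a' (X w) by rewrite eq_le aw' eq we.
  by move: Ya strict; rewrite -same => /eqP <-; rewrite ltNge -eq aw'.
apply: (G_noncrossing eG a'G); exists (X e'.1), (X w); rewrite a'e' !lexx le le' wa' we2 /=.
rewrite (le_trans le le') (le_trans le' we2) (le_trans le' wa').
by split; split=> //; rewrite -a'e' height_fst a'e'.
Qed.

(** If [e'] were steeper, [a'] would be at least as steep as [e], so the wedges could meet only
    along [e]. Then [w] lies on [a'], hence by the flag on [a], which is strictly below [e]. *)
Lemma wedge_slope e a e' a' w : e' \in G -> e \in G ->
  wedge e a w -> wedge e' a' w ->
  (Y w == height a (X w)) = (Y w == height a' (X w)) -> e.1 = e'.1 ->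
  slope e' <= slope e.
Proof.
move=> e'G eG [[aG ae alt _] [wS /andP[ew _] /andP[aw we] _]].
move=> [[a'G a'e' alt' a'max] [_ _ /andP[aw' we'] _]] same e1.
rewrite leNgt; apply/negP => lt; have := a'max _ eG e1 lt.
rewrite -(@height_le _ _ (X w)) //; last by rewrite e1 a'e'.
move=> ea'; have strict : height a (X w) < height e (X w) by rewrite height_lt ?ae.
have : Y w == height a' (X w) by rewrite eq_le aw' (le_trans we ea').
by rewrite -same => /eqP Ya; move: strict; rewrite -Ya ltNge (le_trans ea' aw').
Qed.

Lemma charge_inj e e' c : e \in G -> e' \in G -> charge e c -> charge e' c -> e = e'.
Proof.
move=> eG e'G; case: c => w [t|]; rewrite /charge /=.
  move=> [a wa ta] [a' wa' ta']; have same := etrans (esym ta) ta'.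
  have e1 : e.1 = e'.1.
    apply: injX; apply/eqP; rewrite eq_le !leNgt; apply/andP.
    split; apply/negP; first exact: wedge_apex wa' wa (esym same).
    exact: wedge_apex wa wa' same.
  apply: slope_inj => //; apply/eqP; rewrite eq_le.
  rewrite (wedge_slope eG e'G wa' wa) //.
  by rewrite (wedge_slope e'G eG wa wa').
move=> [-> emin] [e1 emin']; apply: slope_inj => //.
by apply/eqP; rewrite eq_le emin // emin'.
Qed.

(** The factor 3 is the cardinal of [option bool]; the charging replaces Euler's formula. *)
Lemma noncrossing_card : (#|G| <= 3 * #|S|)%N.
Proof.
have -> : (3 * #|S| = #|finset.setX S [set: option bool]|)%N.
  by rewrite cardsX cardsT card_option card_bool mulnC.
apply: (leq_card_rel (P := charge)) => [e|e e' c]; first exact: charge_total.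
exact: charge_inj.
Qed.

End Noncrossing.

(** A line enters only through its trace on [T], from which any two distinct points recover it. *)
Definition line (e : T * T) : {set T} := [set c | Y c == height e (X c)].

Lemma height_collinear e c d : c \in line e -> d \in line e -> c != d ->
  height (c, d) =1 height e.
Proof.
rewrite !inE => /eqP ce /eqP de cd x.
have dX : X d - X c != 0 by rewrite subr_eq0 (inj_eq injX) eq_sym.
have -> : slope e = slope (c, d) -> height (c, d) x = height e x.
- by rewrite {1}/height /= ce /height => ->; ring.
- by [].
by rewrite {2}/slope /= ce de /height; field.
Qed.

Lemma line_collinear e c d : c \in line e -> d \in line e -> c != d ->
  line (c, d) = line e.
Proof.
by move=> ce de cd; apply/setP => x; rewrite !inE (height_collinear ce de).
Qed.

Lemma mem_line_fst e : e.1 \in line e.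
Proof. by rewrite inE height_fst. Qed.

Lemma mem_line_snd e : e.1 != e.2 -> e.2 \in line e.
Proof. by move=> ne; rewrite inE height_snd. Qed.

(** * The graph of consecutive points on rich lines, and its crossings *)

Section RichLines.
Variable j : nat.
Hypothesis j_ge2 : (2 <= j)%N.

Definition rich_lines : {set {set T}} :=
  [set A : {set T} | [exists e : T * T, (e.1 != e.2) && (A == line e)]
                     && (j <= #|A|)%N].

Definition incidences : {set {set T} * T} :=
  [set Ac | (Ac.1 \in rich_lines) && (Ac.2 \in Ac.1)].

Definition edges : {set T * T} :=
  [set e | [&& X e.1 < X e.2, line e \in rich_lines
             & [forall c in line e, ~~ (X e.1 < X c < X e.2)]]].

Lemma card_incidences : #|incidences| = (\sum_(A in rich_lines) #|A|)%N.
Proof.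
under [RHS]eq_bigr do rewrite -sum1_card.
by rewrite pair_big_dep -sum1_card; apply: eq_bigl => -[A c]; rewrite inE.
Qed.

Lemma rich_lines_le_incidences : (j * #|rich_lines| <= #|incidences|)%N.
Proof.
rewrite card_incidences mulnC -sum_nat_const; apply: leq_sum => A.
by rewrite inE => /andP[].
Qed.

(* Every incidence is counted by the edge that leaves the point to the right
   along the line, or else by the line, whose last point it is. *)
Lemma incidences_le_edges : (#|incidences| <= #|edges| + #|rich_lines|)%N.
Proof.
pose top := [set Ac : {set T} * T | [forall d in Ac.1, X d <= X Ac.2]].
rewrite -(cardsID top) addnC; apply: leq_add.
  apply: (leq_card_rel (P := fun Ac e => e.1 = Ac.2 /\ line e = Ac.1)).
    case=> A c; rewrite !inE /= => /andP[/forall_inPn[d0 d0A cd0] /andP[AL cA]].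
    rewrite -ltNge in cd0.
    pose right d := (d \in A) && (X c < X d).
    have d0P : right d0 by rewrite /right d0A.
    case: (arg_minP X d0P) => d /andP[dA cd] dmin.
    have [e ne Ae] : exists2 e, e.1 != e.2 & A = line e.
      by case/andP: AL => /existsP[e /andP[ne /eqP Ae]] _; exists e.
    have lcd : line (c, d) = A.
      by rewrite Ae in cA dA *; apply: line_collinear => //;
        apply: contraTneq cd => ->; rewrite ltxx.
    exists (c, d) => //; rewrite inE /= cd lcd inE AL /=.
    apply/forall_inP => u uA; rewrite negb_and orbC -implyNb negbK -leNgt.
    apply/implyP => ud; rewrite leNgt; apply/negP => cu.
    by have := dmin u; rewrite /right uA cu leNgt ud => /(_ isT).
  by case=> [A c] [A' c'] e _ _ [/= <- <-] [/= <- <-].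
apply: (leq_card_rel (P := fun Ac A => A = Ac.1)) => [[A c]|].
  by rewrite !inE /= => /andP[/andP[AL _] _]; exists A; rewrite ?inE.
case=> [A c] [A' c'] _ /setIP[+ +] /setIP[+ +] /= -> AA'; rewrite !inE /= AA'.
move=> /andP[_ cA] /forall_inP cmax /andP[_ c'A] /forall_inP c'max.
by congr (_, _); apply/injX/eqP; rewrite eq_le cmax // c'max.
Qed.

Lemma edge_lt e : e \in edges -> X e.1 < X e.2.
Proof. by rewrite inE => /andP[]. Qed.

Lemma edge_rich e : e \in edges -> line e \in rich_lines.
Proof. by rewrite inE => /and3P[]. Qed.

Lemma edge_neq e : e \in edges -> e.1 != e.2.
Proof. by move/edge_lt/ltX_neq. Qed.

Lemma edge_empty e c : e \in edges -> X e.1 < X c < X e.2 -> Y c != height e (X c).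
Proof.
rewrite inE => /and3P[_ _ /forall_inP em] lt; apply: contraTneq lt => h.
by apply: em; rewrite inE h.
Qed.

(** Otherwise an endpoint of one edge would lie strictly inside the other, which joins consecutive
    points of the same line. *)
Lemma edge_unique e f z : e \in edges -> f \in edges -> line e = line f ->
  X e.1 < z < X e.2 -> X f.1 < z < X f.2 -> e = f.
Proof.
have le g g' : g \in edges -> g' \in edges -> line g = line g' ->
    X g.1 < z < X g.2 -> X g'.1 < z < X g'.2 -> X g.1 <= X g'.1 /\ X g'.2 <= X g.2.
  move=> gE g'E gg' /andP[g1 g2] /andP[g1' g2']; move: gE.
  rewrite inE => /and3P[_ _ /forall_inP em]; split; rewrite leNgt; apply/negP => lt.
    have := edge_empty g'E (c := g.1); rewrite lt (lt_trans g1 g2') => /(_ isT).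
    by have := mem_line_fst g; rewrite gg' inE => /eqP <-; rewrite eqxx.
  have := edge_empty g'E (c := g.2); rewrite lt (lt_trans g1' g2) => /(_ isT).
  by have := mem_line_snd (ltX_neq (lt_trans g1 g2)); rewrite gg' inE => /eqP <-; rewrite eqxx.
move=> eE fE ef ez fz; have [l u] := le _ _ eE fE ef ez fz.
have [l' u'] := le _ _ fE eE (esym ef) fz ez.
case: e f l u l' u' {eE fE ef ez fz} => [a b] [c d] /= l u l' u'.
by congr (_, _); apply/injX/eqP; rewrite eq_le ?l ?u'.
Qed.

(** Ordered pairs, so that a crossed edge can be charged to a pair having it as first component. *)
Definition crossings : {set (T * T) * (T * T)} :=
  [set ef | [&& ef.1 \in edges, ef.2 \in edges & `[< crossing ef.1 ef.2 >]]].

Lemma height_line e f : e.1 != e.2 -> line e = line f -> height e =1 height f.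
Proof.
move=> ne ef; have := @height_collinear f e.1 e.2.
by rewrite -ef mem_line_fst mem_line_snd // -surjective_pairing; apply.
Qed.

(** The two lines determine the abscissa of the crossing, and this is interior to only one edge of
    each line. *)
Lemma card_crossings : (#|crossings| <= #|rich_lines| ^ 2)%N.
Proof.
rewrite -mulnn -cardsX.
apply: (leq_card_rel (P := fun ef AB => AB = (line ef.1, line ef.2))).
  case=> e f; rewrite inE /= => /and3P[eE fE _]; exists (line e, line f) => //.
  by rewrite finset.in_setX !edge_rich.
move=> [e f] [e' f'] AB; rewrite ![_ \in crossings]inE /= => + + -> [ee' ff'].
move=> /and3P[eE fE /asboolP/crossing_point[z [ez fz zE]]].
move=> /and3P[e'E f'E /asboolP/crossing_point[z' [ez' fz' zE']]].
have hee' := height_line (edge_neq eE) ee'; have hff' := height_line (edge_neq fE) ff'.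
have zz' : z = z' by apply/zE'; rewrite -hee' -hff'; apply/zE.
by subst z'; rewrite (edge_unique eE e'E ee' ez) ?(edge_unique fE f'E ff' fz).
Qed.

(** A shared endpoint would be the only common point of the two lines, but a crossing point is
    interior. Hence a crossing involves four distinct vertices. *)
Lemma crossing_ends e f u : u \in [set e.1; e.2] -> u \in [set f.1; f.2] ->
  X e.1 < X e.2 -> X f.1 < X f.2 -> ~ crossing e f.
Proof.
move=> ue uf lte ltf /crossing_point[z [/andP[ez1 ez2] _ zE]].
have end_height g : X g.1 < X g.2 -> u \in [set g.1; g.2] -> height g (X u) = Y u.
  by move=> lt; rewrite !inE => /orP[]/eqP ->; rewrite ?height_fst ?height_snd ?ltX_neq.
have uz : X u = z by apply/zE; rewrite !end_height.
by move: ue; rewrite !inE => /orP[]/eqP ue; move: ez1 ez2; rewrite -uz ue ltxx.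
Qed.

Definition ends (e : T * T) : {set T} := [set e.1; e.2].

Lemma card_ends e : e \in edges -> #|ends e| = 2%N.
Proof. by move/edge_neq => ne; rewrite cards2 ne. Qed.

Lemma card_crossing_ends ef : ef \in crossings -> #|ends ef.1 :|: ends ef.2| = 4%N.
Proof.
rewrite inE => /and3P[eE fE /asboolP cr].
rewrite cardsU !card_ends // (_ : _ :&: _ = finset.set0) ?cards0 //.
apply/setP => u; rewrite finset.in_setI finset.in_set0; apply/negP => /andP[ue uf].
exact: crossing_ends ue uf (edge_lt eE) (edge_lt fE) cr.
Qed.

(** The edges [G0] that no induced edge crosses form a crossing-free graph; each remaining edge is
    charged to one of its crossings. *)
Lemma edges_induced (S : {set T}) :
  (#|[set e in edges | ends e \subset S]| <=
   3 * #|S| + #|[set ef in crossings | ends ef.1 :|: ends ef.2 \subset S]|)%N.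
Proof.
set G := [set e in _ | _]; set C := [set ef in _ | _].
pose G0 := [set e in G | [forall f in G, ~~ `[< crossing e f >]]].
rewrite -(cardsID G0) leq_add //.
  have GP e : e \in G :&: G0 -> [/\ e \in G, e \in edges, e.1 \in S & e.2 \in S].
    case/setIP=> eG _; split=> //; move: eG; rewrite [_ \in G]inE => /andP[]; first by [];
    by move=> _ /fintype.subsetP; apply; rewrite !inE eqxx ?orbT.
  apply: noncrossing_card => [e /GP[_ eE]|e c /GP[_ eE _ _] _|e f].
  - by split=> //; apply: edge_lt.
  - exact: edge_empty.
  move=> eG /GP[fG _ _ _]; move: eG; rewrite !(inE, finset.in_setI).
  move=> /andP[_ /andP[_ /forall_inP h]].
  by have /asboolPn := h _ fG.
apply: (leq_card_rel (P := fun e (ef : (T * T) * (T * T)) => ef.1 = e));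
  last by move=> e e' [f g] _ _ /= ->.
move=> e.
case/finset.setDP=> eG; rewrite [_ \in G0]inE eG /= => /forall_inPn[f fG].
rewrite negbK => cr; exists (e, f) => //; rewrite !inE /=.
by move: eG fG; rewrite !inE => /andP[-> eS] /andP[-> fS]; rewrite cr finset.subUset eS.
Qed.

(** * Random sampling as an average over all colorings *)

Section Coloring.
Variable K : nat.

(** For a uniform coloring this samples each point independently with probability [1/(K+1)];
    expectations become sums over [f] in [nat]. *)
Let zero_class (f : {ffun T -> 'I_K.+1}) : {set T} := [set x | f x == ord0].

Lemma card_monochromatic (A : {set T}) :
  #|[set f | A \subset zero_class f]| = (K.+1 ^ (#|T| - #|A|))%N.
Proof.
have -> : (#|T| - #|A| = #|~: A|)%N by rewrite -[#|T|](cardsC A) addKn.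
transitivity #|pffun_on (ord0 : 'I_K.+1) (mem (~: A)) predT|; last first.
  by rewrite card_pffun_on (@eq_card _ predT 'I_K.+1) ?card_ord.
apply: eq_card => f; rewrite inE; apply/fintype.subsetP/pffun_onP => [Af|[sub _] x xA].
  split=> //; apply/fintype.subsetP => x; rewrite inE => fx.
  by rewrite !inE; apply: contra fx => /Af; rewrite inE.
rewrite inE; apply: contraLR xA => fx.
by have /fintype.subsetP/(_ x) := sub; rewrite !inE; apply.
Qed.

(** Linearity of expectation: after exchanging the sums, each [i] contributes the number of
    colorings that are [0] on [s i]. *)
Lemma sum_monochromatic (I : finType) (D : {set I}) (s : I -> {set T}) (r : nat) :
  {in D, forall i, #|s i| = r} ->
  (\sum_f #|[set i in D | s i \subset zero_class f]| = #|D| * K.+1 ^ (#|T| - r))%N.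
Proof.
move=> sr.
under eq_bigr do rewrite -sum1_card.
under eq_bigr => f _ do under eq_bigl do rewrite inE.
under eq_bigr => f _ do rewrite big_mkcondr.
rewrite exchange_big /= -sum_nat_const; apply: eq_bigr => i iD.
rewrite -(sr i iD) -card_monochromatic -sum1_card [RHS]big_mkcond.
by apply: eq_bigr => f _; rewrite inE.
Qed.

(** Vertices, edges and crossings survive with probabilities [q], [q^2] and [q^4], where
    [q = 1/(K+1)]; average [edges_induced] and multiply by [(K+1)^4]. *)
Lemma edges_sampled : (3 < #|T|)%N ->
  (#|edges| * K.+1 ^ 2 <= 3 * #|T| * K.+1 ^ 3 + #|crossings|)%N.
Proof.
move=> T4.
have : (\sum_f #|[set e in edges | ends e \subset zero_class f]| <=
  \sum_f (3 * #|[set x in [set: T] | [set x] \subset zero_class f]|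
      + #|[set ef in crossings | ends ef.1 :|: ends ef.2 \subset zero_class f]|))%N.
  apply: leq_sum => f _; apply: leq_trans (edges_induced _) _.
  rewrite leq_add2r leq_mul2l /=; apply: eq_leq; apply: eq_card => x.
  by rewrite !inE finset.sub1set inE.
rewrite big_split -big_distrr /= (sum_monochromatic card_ends).
rewrite (sum_monochromatic card_crossing_ends).
rewrite (sum_monochromatic (r := 1)) => [|x _]; last exact: cards1.
(* By [T4] no subtraction in the exponents is truncated, and the common power [K.+1 ^ m] cancels. *)
rewrite cardsT -(subnK T4) !addnK.
set m := (#|T| - 4)%N.
have -> : (m + 4 - 2 = 2 + m)%N by lia.
have -> : (m + 4 - 1 = 3 + m)%N by lia.
rewrite !expnD !mulnA -mulnDl leq_pmul2r ?expn_gt0 //.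
Qed.

End Coloring.

Lemma incidences_sampled K : (3 < #|T|)%N -> (0 < K)%N ->
  (#|incidences| * K ^ 2 <= 6 * #|T| * K ^ 3 + 2 * #|rich_lines| ^ 2)%N.
Proof.
case: K => // K T4 _; have := edges_sampled K T4; have cr := card_crossings.
(* Since [j >= 2], the last points of the lines are at most half of the incidences, which leaves at
   least half to the edges. *)
have M2 : (2 * #|rich_lines| <= #|incidences|)%N.
  by apply: leq_trans rich_lines_le_incidences; rewrite leq_mul2r j_ge2 orbT.
have : (#|incidences| <= 2 * #|edges|)%N by have := incidences_le_edges; lia.
rewrite -(leq_pmul2r (expn_gt0 K.+1 2)) => Ie; lia.
Qed.

Theorem incidences_bound : (3 < #|T|)%N ->
  (#|incidences| * j ^ 2 <= 2304 * (#|T| ^ 2 + #|T| * j ^ 2))%N.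
Proof.
move=> T4; apply: optimize_sampling rich_lines_le_incidences _.
  exact: leq_trans j_ge2.
by move=> K; apply: incidences_sampled.
Qed.

End RichLines.

End Plane.

(** * Inner products, right angles, common perpendiculars and generic vectors in space *)

Section Space.
Variable R : realType.
Implicit Types u v w : point R.

Lemma dotC u v : dot u v = dot v u.
Proof. by apply: eq_bigr => i _; rewrite mulrC. Qed.

Lemma dotDr u v w : dot u (v + w) = dot u v + dot u w.
Proof. by rewrite -big_split; apply: eq_bigr => i _; rewrite mxE mulrDr. Qed.

Lemma dotZr u t v : dot u (t *: v) = t * dot u v.
Proof. by rewrite /dot mulr_sumr; apply: eq_bigr => i _; rewrite mxE mulrCA. Qed.

Lemma dotBr u v w : dot u (v - w) = dot u v - dot u w.
Proof. by rewrite -[- w]scaleN1r dotDr dotZr mulN1r. Qed.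

Lemma dot_ge0 u : 0 <= dot u u.
Proof. by apply: sumr_ge0 => i _; rewrite -expr2 sqr_ge0. Qed.

Lemma dot_eq0 u : dot u u = 0 -> u = 0.
Proof.
move=> /eqP; rewrite psumr_eq0 => [/allP h|i _]; last by rewrite -expr2 sqr_ge0.
apply/rowP => i; rewrite mxE; have := h i (mem_index_enum _).
by rewrite -expr2 sqrf_eq0 => /eqP.
Qed.

Lemma cauchy_schwarz u v : dot u v ^+ 2 <= dot u u * dot v v.
Proof.
have [/dot_eq0->|v0] := eqVneq (dot v v) 0.
  by rewrite -(scale0r 0) !dotZr !mul0r mulr0 expr0n.
have vp : 0 < dot v v by rewrite lt0r v0 dot_ge0.
have := dot_ge0 (dot v v *: u - dot u v *: v).
rewrite dotBr !dotZr ![dot (_ - _) _]dotC !dotBr !dotZr (dotC v u).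
rewrite (_ : _ - _ = dot v v * (dot u u * dot v v - dot u v ^+ 2)); last by ring.
by rewrite pmulr_rge0 // subr_ge0.
Qed.

Lemma enorm_gt0 u : u != 0 -> 0 < enorm u.
Proof.
move=> u0; rewrite sqrtr_gt0 lt0r dot_ge0 andbT.
by apply: contra_neq u0 => /dot_eq0.
Qed.

(** By Cauchy-Schwarz the argument of [acos] lies in [[-1, 1]], where [acosK] applies; taking
    cosines shows that the quotient is zero. *)
Lemma angle_pihalf (a b c : point R) : a != b -> c != b ->
  angle a b c = pi / 2 -> dot (a - b) (c - b) = 0.
Proof.
rewrite -subr_eq0 => ab; rewrite -(subr_eq0 c) => cb; rewrite /angle.
move: (a - b) (c - b) ab cb => u v u0 v0.
have nuv : 0 < enorm u * enorm v by rewrite mulr_gt0 ?enorm_gt0.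
have le1 : `|dot u v / (enorm u * enorm v)| <= 1.
  rewrite normrM normfV (gtr0_norm nuv) ler_pdivrMr // mul1r.
  rewrite -(@ler_pXn2r _ 2) ?nnegrE ?normr_ge0 ?(ltW nuv) //.
  rewrite real_normK ?num_real // exprMn !sqr_sqrtr ?dot_ge0 //.
  exact: cauchy_schwarz.
move=> h; have := @acosK R (dot u v / (enorm u * enorm v)).
rewrite in_itv /= -ler_norml le1 h cos_pihalf => /(_ isT)/esym/eqP.
by rewrite mulf_eq0 invr_eq0 (gt_eqF nuv) orbF => /eqP.
Qed.

(* The difference [w] of two common perpendiculars lies in the span of the two
   directions and is orthogonal to both, so it vanishes. *)
Lemma common_perpendicular_unique (a b b' c c' d : point R) :
  a != b -> a != b' -> c' != d -> ~ parallel_lines a b c d ->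
  line_through a b b' -> line_through c d c' ->
  dot (a - b) (c - b) = 0 -> dot (b - c) (d - c) = 0 ->
  dot (a - b') (c' - b') = 0 -> dot (b' - c') (d - c') = 0 ->
  b = b' /\ c = c'.
Proof.
move=> ab ab' cd' np [s b'E] [t c'E].
pose e1 := b - a; pose e2 := d - c.
have e1n : e1 != 0 by rewrite subr_eq0 eq_sym.
(* As [a - b'] and [d - c'] are nonzero multiples of [e1] and [e2], their orthogonality relations
   pass to these directions. *)
have s0 : s != 0 by apply: contra_neq ab' => s0; rewrite b'E s0 scale0r addr0.
have t1 : 1 - t != 0.
  by rewrite subr_eq0; apply: contra_neq cd' => t1; rewrite c'E -t1 scale1r addrC subrK.
have ab'E : a - b' = - s *: e1 by rewrite b'E opprD addNKr scaleNr.
have dc'E : d - c' = (1 - t) *: e2 by rewrite c'E scalerBl scale1r opprD addrA.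
have abE : a - b = - 1 *: e1 by rewrite scaleN1r opprB.
rewrite abE ab'E dc'E -/e2 !dotZr ![dot (_ *: e1) _]dotC !dotZr ![dot _ e1]dotC.
move=> /eqP; rewrite mulf_eq0 oppr_eq0 oner_eq0 /= => /eqP o1 o2.
move=> /eqP; rewrite mulf_eq0 oppr_eq0 (negPf s0) /= => /eqP o3.
move=> /eqP; rewrite mulf_eq0 (negPf t1) /= => /eqP o4.
pose w := (c' - b') - (c - b).
have wE : w = t *: e2 - (s - 1) *: e1.
  by rewrite /w c'E b'E -/e1 -/e2 /e1; apply/rowP => i; rewrite !mxE; ring.
have w1 : dot w e1 = 0 by rewrite dotC dotBr o1 o3 subrr.
have w2 : dot w e2 = 0.
  by rewrite dotC dotBr -(opprB b') -(opprB b c) -![- (_ - _)]scaleN1r !dotZr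
    ![dot e2 _]dotC o2 o4 subrr.
have /dot_eq0 : dot w w = 0 by rewrite {2}wE dotBr !dotZr w1 w2 !mulr0 subrr.
rewrite wE => /eqP; rewrite subr_eq0 => /eqP te.
have t0 : t = 0.
  apply: contrapT => /eqP t0; apply: np; exists (t^-1 * (s - 1)).
  by rewrite -scalerA -te scalerA mulVf // scale1r.
move: te => /eqP; rewrite t0 scale0r eq_sym scaler_eq0 (negPf e1n) orbF subr_eq0 => /eqP s1.
by rewrite b'E c'E s1 t0 scale0r scale1r addr0 subrKC.
Qed.

(** The first [size q] naturals are distinct in [R], and they are more numerous than the degree
    allows for roots. *)
Lemma poly_nonroot (q : {poly R}) : q != 0 -> exists t, q.[t] != 0.
Proof.
move=> q0; apply: contrapT => h.
have roots : all (root q) [seq i%:R | i <- iota 0 (size q)].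
  by apply/allP => t _; apply/negPn/negP => qt; apply: h; exists t.
have uniq_roots : uniq [seq i%:R : R | i <- iota 0 (size q)].
  by rewrite map_inj_uniq ?iota_uniq // => i i' /eqP; rewrite eqr_nat => /eqP.
by have := max_poly_roots q0 roots uniq_roots; rewrite size_map size_iota ltnn.
Qed.

(* The vector is taken on the moment curve [(1, t, t^2)]. *)
Lemma generic_vector (s : seq (point R)) :
  all (fun d => d != 0) s -> exists u, all (fun d => dot u d != 0) s.
Proof.
move=> s0.
(* On the curve, [dot u d] is the value of [rVpoly d] at [t], so a non-root of the product serves
   all [d] at once. *)
have prod0 : \prod_(d <- s) rVpoly d != 0.
  rewrite prodf_seq_neq0; apply/allP => d /(allP s0); apply: contra => /eqP d0.
  by rewrite -(rVpolyK d) d0 raddf0.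
have [t] := poly_nonroot prod0; rewrite horner_prod prodf_seq_neq0 => /allP t0.
exists (\row_i t ^+ i); apply/allP => d /t0.
rewrite (horner_coef_wide _ (size_poly _ _)); congr (_ != 0).
by apply: eq_bigr => i _; rewrite coef_rVpoly_ord mxE mulrC.
Qed.

(** * Projection of a finite spatial configuration to the plane *)

Section Configuration.
Variables (T : finType) (p : T -> point R).
Hypothesis injp : injective p.

Definition trace_line (a b : T) : {set T} :=
  [set c | `[< line_through (p a) (p b) (p c) >]].

(** The coordinates are inner products with generic [u] and [v]: [u] separates the points, and then
    [v] is chosen so that no new collinearity appears. *)
Lemma generic_projection : exists X Y : T -> R, injective X /\
  forall e, e.1 != e.2 -> line X Y e = trace_line e.1 e.2.
Proof.
pose differences := [seq p e.2 - p e.1 | e <- enum {: T * T} & e.1 != e.2].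
have [u u0] : exists u, all (fun d => dot u d != 0) differences.
  apply/generic_vector/allP => d /mapP[[a b]].
  by rewrite mem_filter /= => /andP[ab _] ->; rewrite subr_eq0 (inj_eq injp) eq_sym.
pose X a := dot u (p a).
have injX : injective X.
  move=> a b ab; apply: contrapT => /eqP ne.
  have /(allP u0) : p b - p a \in differences.
    by apply/mapP; exists (a, b) => //; rewrite mem_filter mem_enum ne.
  by rewrite dotBr /X in ab *; rewrite ab subrr eqxx.
(* For [a != b] this vanishes only if the three points of space are collinear, while its product
   with [v] vanishes when their projections are. *)
pose normal (a b c : T) := (X b - X a) *: (p c - p a) - (X c - X a) *: (p b - p a).
pose normals := [seq d <- [seq normal x.1.1 x.1.2 x.2 | x <- enum {: T * T * T}] | d != 0].
have [v v0] : exists v, all (fun d => dot v d != 0) normals.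
  by apply/generic_vector/allP => d; rewrite mem_filter => /andP[].
pose Y a := dot v (p a).
exists X, Y; split=> // -[a b] /= ab; apply/setP => c; rewrite !inE /height /slope /=.
have Xab : X b - X a != 0 by rewrite subr_eq0 (inj_eq injX) eq_sym.
have Xp t a' b' : dot t (p b' - p a') = dot t (p b') - dot t (p a') by rewrite dotBr.
apply/eqP/asboolP => [YE|[t cE]].
  have vw : dot v (normal a b c) = 0.
    by rewrite dotBr !dotZr !dotBr -/(Y a) -/(Y b) -/(Y c) YE; field.
  have : normal a b c = 0.
    apply: contrapT => /eqP w0.
    have /(allP v0) : normal a b c \in normals; last by rewrite vw eqxx.
    rewrite mem_filter w0; apply/mapP; exists (a, b, c) => //.
    by rewrite mem_enum.
  move=> /eqP; rewrite subr_eq0 => /eqP E.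
  exists ((X b - X a)^-1 * (X c - X a)).
  by rewrite -scalerA -E scalerA mulVf // scale1r subrKC.
have Xc : X c = X a + t * (X b - X a) by rewrite /X cE dotDr dotZr dotBr.
have -> : Y c = Y a + t * (Y b - Y a) by rewrite /Y cE dotDr dotZr dotBr.
by rewrite Xc; field.
Qed.

Definition rich_incidences (j : nat) : {set {set T} * T} :=
  [set Ac | [&& [exists e : T * T, (e.1 != e.2) && (Ac.1 == trace_line e.1 e.2)],
               (j <= #|Ac.1|)%N & Ac.2 \in Ac.1]].

(** As the projection preserves the traces of lines, the spatial incidences are the same set as the
    planar ones. *)
Lemma rich_incidences_bound j : (2 <= j)%N -> (3 < #|T|)%N ->
  (#|rich_incidences j| * j ^ 2 <= 2304 * (#|T| ^ 2 + #|T| * j ^ 2))%N.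
Proof.
move=> j2 T4; have [X [Y [injX lineE]]] := generic_projection.
rewrite (_ : rich_incidences j = incidences X Y j).
  exact: incidences_bound.
apply/setP => -[A c]; rewrite !inE /= andbA; congr (_ && _ && _).
by apply: eq_existsb => e; have [//|/lineE ->] := eqVneq e.1 e.2.
Qed.

Lemma trace_line_fst a b : a \in trace_line a b.
Proof. by rewrite inE; apply/asboolP; exists 0; rewrite scale0r addr0. Qed.

Lemma trace_line_snd a b : b \in trace_line a b.
Proof. by rewrite inE; apply/asboolP; exists 1; rewrite scale1r subrKC. Qed.

Lemma mem_rich_incidences j a b c : a != b -> (j <= #|trace_line a b|)%N ->
  c \in trace_line a b -> (trace_line a b, c) \in rich_incidences j.
Proof.
move=> ab jab cab; rewrite inE /= jab cab !andbT.
by apply/existsP; exists (a, b); rewrite ab eqxx.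
Qed.

End Configuration.

(** * From tuples to pairs of incidences *)

Lemma rich_trace_line (E : {fset point R}) j (a b : E) :
  rich E j (line_through (val a) (val b)) -> (j <= #|trace_line val a b|)%N.
Proof.
rewrite /rich cardfE => /leq_trans; apply; rewrite -cardsT.
apply: (leq_card_rel (P := fun x c => val x = val c)) => [[x xF] _|x x' y _ _ /= xy x'y].
  have := xF; rewrite !inE /= => /andP[xE xL].
  by exists [` xE]%fset => //; rewrite inE.
by apply: val_inj; exact: etrans xy (esym x'y).
Qed.

(** A tuple is sent to the incidences of [x1] and [x4]; the middle points are recovered as the feet
    of the common perpendicular. *)
Lemma card_good_tuples (E : {fset point R}) j k :
  (#|` good_tuples E j k| <=
   #|@rich_incidences E val j| * #|@rich_incidences E val k|)%N.
Proof.
rewrite cardfE -cardsT -cardsX.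
apply: (leq_card_rel (P := fun (x : good_tuples E j k) y => exists a b c d : E,
  val x = (val a, val b, val c, val d) /\
  y = ((trace_line val a b, a), (trace_line val c d, d)))).
  case=> [[[[x1 x2] x3] x4] xG] _; have := xG.
  rewrite !inE /= => /andP[/andP[/andP[/andP[E1 E2] E3] E4]].
  move=> /asboolP[[n12 n23 n34] [_ _ r12 r34 _]].
  pose a := [` E1]%fset; pose b := [` E2]%fset; pose c := [` E3]%fset; pose d := [` E4]%fset.
  exists ((trace_line val a b, a), (trace_line val c d, d)); last by exists a, b, c, d.
  rewrite finset.in_setX !mem_rich_incidences ?trace_line_fst ?trace_line_snd //.
  - exact: rich_trace_line.
  - exact: rich_trace_line.
have good (x : good_tuples E j k) a b c d : val x = (a, b, c, d) -> good_tuple E j k a b c d.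
  move=> xE; have := valP x; rewrite xE !inE /= => /andP[_ /asboolP]; exact.
move=> x x' _ _ _ [a [b [c [d [xE ->]]]]] [a' [b' [c' [d' [xE' [lab aa' lcd dd']]]]]].
subst a' d'; apply: val_inj; rewrite xE xE'.
have [[ab bc cd] [abc bcd _ _ np]] := good _ _ _ _ _ xE.
have [[ab' bc' cd'] [abc' bcd' _ _ _]] := good _ _ _ _ _ xE'.
(* Equal traces put the feet of the second tuple on the lines of the first. *)
have : b' \in trace_line val a b by rewrite lab trace_line_snd.
have : c' \in trace_line val c d by rewrite lcd trace_line_fst.
rewrite !inE => lc lb.
have angle_dot (q r s : point R) : q != r -> r != s ->
    angle q r s = pi / 2 -> dot (q - r) (s - r) = 0.
  by move=> qr rs; apply: angle_pihalf; rewrite // eq_sym.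
by have [-> ->] := common_perpendicular_unique ab ab' cd' np lb lc
  (angle_dot _ _ _ ab bc abc) (angle_dot _ _ _ bc cd bcd)
  (angle_dot _ _ _ ab' bc' abc') (angle_dot _ _ _ bc' cd' bcd').
Qed.

End Space.

Theorem theorem4p4 (R : realType) :
  exists (C : R) (N : nat),
    forall (n : nat) (E : {fset point R}) (j k : nat),
      (N < n)%N -> #|` E| = n -> (2 <= j)%N -> (2 <= k)%N ->
      (#|` good_tuples E j k|)%:R <=
        C * ((n%:R ^+ 2 / j%:R ^+ 2 + n%:R) * (n%:R ^+ 2 / k%:R ^+ 2 + n%:R)).
Proof.
(* Each of the two lines contributes a factor 2304, and the sampling argument requires at least four
   points. *)
exists (2304 ^+ 2), 3%N => n E j k n3 En j2 k2.
have bound i : (2 <= i)%N ->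
    #|@rich_incidences R E val i|%:R <= 2304 * (n%:R ^+ 2 / i%:R ^+ 2 + n%:R) :> R.
  move=> i2; have i0 : (0 : R) < i%:R ^+ 2 by rewrite exprn_gt0 // ltr0n; lia.
  have := @rich_incidences_bound R E val val_inj i i2; rewrite -cardfE En => /(_ n3).
  rewrite -(ler_nat R) !(natrM, natrD, natrX) -ler_pdivlMr // => /le_trans; apply.
  by rewrite le_eqVlt; apply/orP; left; apply/eqP; field; rewrite gt_eqF // ltr0n; lia.
apply: (@le_trans _ _ (#|@rich_incidences R E val j| * #|@rich_incidences R E val k|)%N%:R).
  by rewrite ler_nat card_good_tuples.
rewrite natrM expr2 mulrACA; apply: ler_pM; rewrite ?ler0n ?bound //.
Qed.
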